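(* Let $D=xy\frac{\partial}{\partial x}+x^2\frac{\partial}{\partial y}$ be the derivation on Laurent polynomials in $x,y$ with $D(x)=xy$, $D(y)=x^2$, and for a Laurent polynomial $f$ let $\mathrm{Gen}(f,t)=\sum_{n\ge0}D^n(f)\frac{t^n}{n!}$. Then $$\mathrm{Gen}(x^{-1},t)=\frac{\sqrt{y^2-x^2}\cosh\big(t\sqrt{y^2-x^2}\big)-y\sinh\big(t\sqrt{y^2-x^2}\big)}{x\sqrt{y^2-x^2}}.$$
   Context: The right-hand side is a formal power series in $t$: with $s=\sqrt{y^2-x^2}$, $\cosh(ts)=\sum_{n\ge0}s^{2n}\frac{t^{2n}}{(2n)!}$ and $\sinh(ts)/s=\sum_{n\ge0}s^{2n}\frac{t^{2n+1}}{(2n+1)!}$, so only even powers of $s$, i.e. powers of $y^2-x^2$, occur. *)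

(* Defs.v *)
From HB Require Import structures.
From mathcomp Require Import all_boot all_algebra all_field.
From mathcomp Require Import finmap.
From mathcomp.multinomials Require Import xfinmap monalg.
From mathcomp Require Import ring zify.
From Stdlib Require Import Classical.

Set Implicit Arguments.
Unset Strict Implicit.
Unset Printing Implicit Defensive.

Import GRing.Theory.
Local Open Scope fset_scope.
Local Open Scope ring_scope.

(* Laurent polynomials in x, y over F: finitely supported families of
   coefficients indexed by exponents (i, j) in Z^2, where (i, j) stands for
   x^i y^j.  The product of monalg cannot be reused: it asks for a monomial
   monoid without nontrivial units, hence the convolution below. *)
Definition laurent (F : fieldType) : Type := {malg F[(int * int)%type]}.

HB.instance Definition _ (F : fieldType) := GRing.Lmodule.on (laurent F).

(* term c (i, j) is the Laurent monomial c x^i y^j.  It and the product are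
   locked because failed matches against them would otherwise unfold them. *)
HB.lock Definition term (F : fieldType) (c : F) (k : int * int) : laurent F :=
  mkmalgU k c.

HB.lock Definition lmul (F : fieldType) (f g : laurent F) : laurent F :=
  \sum_(k <- msupp f) \sum_(l <- msupp g) term (f@_k * g@_l) (k + l).

Section LaurentRing.
Variable F : fieldType.
Implicit Types (f g h : laurent F) (k l : int * int) (c : F).

Local Notation term := (@term F).
Local Notation lmul := (@lmul F).

Definition lone : laurent F := term 1 0.

Lemma term0 k : term 0 k = 0.
Proof. rewrite term.unlock; exact: monalgU0. Qed.

Lemma termD k : {morph term^~ k : c d / c + d}.
Proof. rewrite term.unlock; exact: monalgUD. Qed.

Lemma coef_term c k l : (term c k)@_l = c *+ (k == l).
Proof. rewrite term.unlock; exact: mcoeffU. Qed.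

Lemma msupp_term c k : msupp (term c k) `<=` [fset k].
Proof. rewrite term.unlock; exact: msuppU_le. Qed.

Lemma termZ a c k : a *: term c k = term (a * c) k.
Proof. by apply/malgP=> l; rewrite mcoeffZ !coef_term mulrnAr. Qed.

Lemma laurentE f : f = \sum_(k <- msupp f) term f@_k k.
Proof. rewrite term.unlock; exact: monalgE. Qed.

Lemma lmulw (d1 d2 : {fset int * int}) f g :
  msupp f `<=` d1 -> msupp g `<=` d2 ->
  lmul f g = \sum_(k <- d1) \sum_(l <- d2) term (f@_k * g@_l) (k + l).
Proof.
move=> le1 le2; rewrite lmul.unlock (big_fset_incl _ le1) /=.
  apply/eq_bigr=> k _; apply/big_fset_incl => // l _ /mcoeff_outdom ->.
  by rewrite mulr0 term0.
move=> k _ /mcoeff_outdom fk.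
by rewrite big1 => // l _; rewrite fk mul0r term0.
Qed.

Lemma lmulUU c d k l : lmul (term c k) (term d l) = term (c * d) (k + l).
Proof.
by rewrite (lmulw (msupp_term _ _) (msupp_term _ _)) !big_seq_fset1 !coef_term !eqxx.
Qed.

Lemma lmulC : commutative lmul.
Proof.
move=> f g; rewrite lmul.unlock exchange_big /=.
by apply/eq_bigr=> k _; apply/eq_bigr=> l _; rewrite mulrC addrC.
Qed.

Lemma lmulDl : left_distributive lmul +%R.
Proof.
move=> f g h.
rewrite [in RHS](lmulw (fsubsetUl _ (msupp g)) (fsubset_refl _)).
rewrite [in RHS](lmulw (fsubsetUr (msupp f) _) (fsubset_refl _)).
rewrite (lmulw (msuppD_le _ _) (fsubset_refl _)).
rewrite -big_split /=; apply/eq_bigr=> k _.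
rewrite -big_split /=; apply/eq_bigr=> l _.
by rewrite mcoeffD mulrDl termD.
Qed.

Lemma lmul0 f : lmul 0 f = 0.
Proof. by rewrite lmul.unlock msupp0 big_seq_fset0. Qed.

Lemma lmul_suml I (r : seq I) (G : I -> laurent F) h :
  lmul (\sum_(i <- r) G i) h = \sum_(i <- r) lmul (G i) h.
Proof. exact: (big_morph (lmul^~ h) (fun a b => lmulDl a b h) (lmul0 h)). Qed.

(* Properties linear in each argument only need checking on monomials. *)
Lemma laurent_ind (P : laurent F -> Prop) :
  P 0 -> (forall f g, P f -> P g -> P (f + g)) -> (forall c k, P (term c k)) ->
  forall f, P f.
Proof.
move=> P0 PD PU f; rewrite (laurentE f).
by elim/big_ind: _ => // k _; apply: PU.
Qed.

Lemma lmulDr : right_distributive lmul +%R.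
Proof. by move=> f g h; rewrite !(lmulC f) lmulDl. Qed.

Lemma lmulA : associative lmul.
Proof.
move=> f g h.
elim/laurent_ind: f => [|f1 f2 I1 I2|c k]; first by rewrite !lmul0.
  by rewrite !lmulDl I1 I2.
elim/laurent_ind: g => [|g1 g2 I1 I2|d l].
- by rewrite lmul0 (lmulC _ 0) !lmul0.
- by rewrite lmulDl !lmulDr lmulDl I1 I2.
elim/laurent_ind: h => [|h1 h2 I1 I2|e m].
- by rewrite !(lmulC _ 0) !lmul0 (lmulC _ 0) lmul0.
- by rewrite !lmulDr I1 I2.
by rewrite !lmulUU mulrA addrA.
Qed.

Lemma lmul1 : left_id lone lmul.
Proof.
move=> f; elim/laurent_ind: f => [|f g I1 I2|c k].
- by rewrite lmulC lmul0.
- by rewrite lmulDr I1 I2.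
- by rewrite lmulUU mul1r add0r.
Qed.

Lemma lone_neq0 : lone != 0.
Proof.
apply/eqP=> /malgP/(_ 0) /eqP.
by rewrite coef_term eqxx mcoeff0 oner_eq0.
Qed.

HB.instance Definition _ := GRing.Zmodule_isComNzRing.Build (laurent F)
  lmulA lmulC lmul1 lmulDl lone_neq0.

Lemma termM c d k l : term c k * term d l = term (c * d) (k + l).
Proof. exact: lmulUU. Qed.

Lemma lscaleAl c f g : c *: (f * g) = (c *: f) * g.
Proof.
elim/laurent_ind: f => [|f1 f2 I1 I2|a k]; first by rewrite mul0r !scaler0 mul0r.
  by rewrite mulrDl !scalerDr mulrDl I1 I2.
elim/laurent_ind: g => [|g1 g2 I1 I2|b l]; first by rewrite !mulr0 scaler0.
  by rewrite !mulrDr scalerDr I1 I2.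
by rewrite termZ !termM termZ mulrA.
Qed.

HB.instance Definition _ :=
  GRing.Lmodule_isLalgebra.Build F (laurent F) lscaleAl.
HB.instance Definition _ := GRing.Lalgebra_isComAlgebra.Build F (laurent F).

End LaurentRing.

Section Derivation.
Variable F : fieldType.
Implicit Types (f g : laurent F) (k : int * int) (c : F).

Definition lx : laurent F := term 1 (1, 0).
Definition ly : laurent F := term 1 (0, 1).
Definition lxV : laurent F := term 1 (-1, 0).

Lemma mul_lx_lxV : lx * lxV = 1.
Proof. by rewrite termM mulr1. Qed.

Definition dx f : laurent F :=
  \sum_(k <- msupp f) term (k.1%:~R * f@_k) (k.1 - 1, k.2).

Definition dy f : laurent F :=
  \sum_(k <- msupp f) term (k.2%:~R * f@_k) (k.1, k.2 - 1).

(* The derivation xy d/dx + x^2 d/dy; see DxyD, DxyM, Dxy_lx and Dxy_ly. *)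
Definition Dxy f : laurent F := lx * ly * dx f + lx ^+ 2 * dy f.

Lemma dxw (d : {fset int * int}) f : msupp f `<=` d ->
  dx f = \sum_(k <- d) term (k.1%:~R * f@_k) (k.1 - 1, k.2).
Proof.
move=> le; apply: big_fset_incl => // k _ /mcoeff_outdom ->.
by rewrite mulr0 term0.
Qed.

Lemma dyw (d : {fset int * int}) f : msupp f `<=` d ->
  dy f = \sum_(k <- d) term (k.2%:~R * f@_k) (k.1, k.2 - 1).
Proof.
move=> le; apply: big_fset_incl => // k _ /mcoeff_outdom ->.
by rewrite mulr0 term0.
Qed.

Lemma dx_term c k : dx (term c k) = term (k.1%:~R * c) (k.1 - 1, k.2).
Proof. by rewrite (dxw (msupp_term _ _)) big_seq_fset1 coef_term eqxx. Qed.

Lemma dy_term c k : dy (term c k) = term (k.2%:~R * c) (k.1, k.2 - 1).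
Proof. by rewrite (dyw (msupp_term _ _)) big_seq_fset1 coef_term eqxx. Qed.

Lemma dxD : {morph dx : f g / f + g}.
Proof.
move=> f g; rewrite (dxw (msuppD_le _ _)) (dxw (fsubsetUl _ (msupp g))).
rewrite (dxw (fsubsetUr (msupp f) _)) -big_split /=.
by apply: eq_bigr => k _; rewrite mcoeffD mulrDr termD.
Qed.

Lemma dyD : {morph dy : f g / f + g}.
Proof.
move=> f g; rewrite (dyw (msuppD_le _ _)) (dyw (fsubsetUl _ (msupp g))).
rewrite (dyw (fsubsetUr (msupp f) _)) -big_split /=.
by apply: eq_bigr => k _; rewrite mcoeffD mulrDr termD.
Qed.

Lemma Dxy_term c k : Dxy (term c k) =
  term (k.1%:~R * c) (k.1, k.2 + 1) + term (k.2%:~R * c) (k.1 + 2, k.2 - 1).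
Proof.
rewrite /Dxy dx_term dy_term expr2 !termM !mul1r.
by congr (term _ _ + term _ _); apply/eqP; rewrite xpair_eqE /=;
  apply/andP; split; apply/eqP; ring.
Qed.

Lemma DxyD : {morph Dxy : f g / f + g}.
Proof. by move=> f g; rewrite /Dxy dxD dyD !mulrDr addrACA. Qed.

Lemma Dxy0 : Dxy 0 = 0.
Proof. by rewrite /Dxy /dx /dy msupp0 !big_seq_fset0 !mulr0 addr0. Qed.

Lemma DxyM f g : Dxy (f * g) = Dxy f * g + f * Dxy g.
Proof.
elim/laurent_ind: f => [|f1 f2 I1 I2|c k].
- by rewrite !(mul0r, Dxy0) addr0.
- by rewrite mulrDl !DxyD I1 I2 !mulrDl addrACA.
elim/laurent_ind: g => [|g1 g2 I1 I2|d l].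
- by rewrite !(mulr0, Dxy0) addr0.
- by rewrite mulrDr !DxyD I1 I2 !mulrDr addrACA.
case: k l => [k1 k2] [l1 l2].
rewrite termM !Dxy_term mulrDl mulrDr !termM [RHS]addrACA.
have P (a b a' b' : int) : a = a' -> b = b' -> (a, b) = (a', b') by move=> -> ->.
have E a b e (m n p : int * int) : a = b + e -> p = m -> p = n ->
  term a p = term b m + term e n.
  by move=> -> <- <-; rewrite termD.
congr (_ + _); apply: E.
all: try by rewrite /= intrD; ring.
all: by apply: P => /=; ring.
Qed.

Lemma Dxy_lx : Dxy lx = lx * ly.
Proof. by rewrite Dxy_term /= mul0r term0 addr0 termM mul1r. Qed.

Lemma Dxy_ly : Dxy ly = lx ^+ 2.
Proof. by rewrite Dxy_term /= mul0r term0 add0r expr2 termM mul1r. Qed.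

End Derivation.

Arguments lx {F}.
Arguments ly {F}.
Arguments lxV {F}.

Lemma adjoin_sqrt (K : fieldType) (q : K) :
  exists (L : fieldType) (j : {rmorphism K -> L}) (s : L), s ^+ 2 = j q.
Proof.
have [[s sq]|nos] := classic (exists s : K, s ^+ 2 = q); first by exists K, idfun, s.
have irr : irreducible_poly ('X^2 - q%:P).
  apply: cubic_irreducible; rewrite ?size_XnsubC // => z; apply/negP=> /rootP.
  by rewrite !hornerE => /subr0_eq zq; apply: nos; exists z.
have [L _ [z rz _]] := irredp_FAdjoin irr.
exists L, (in_alg L), z; move/rootP: rz.
by rewrite rmorphB /= map_polyXn map_polyC !hornerE => /subr0_eq.
Qed.

Section SquareRoot.
Variable F : fieldType.
Implicit Types (f g : laurent F) (k : int * int) (c : F).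

Let K0 : fieldType := {fraction {poly {poly F}}}.
Let X : K0 := tofrac 'X%:P.
Let Y : K0 := tofrac 'X.
Let cst c : K0 := tofrac c%:P%:P.
Let val_term c k : K0 := cst c * (X ^ k.1 * Y ^ k.2).
Let phi f : K0 := \sum_(k <- msupp f) val_term f@_k k.

Let X0 : X != 0. Proof. by rewrite tofrac_eq0 polyC_eq0 polyX_eq0. Qed.
Let Y0 : Y != 0. Proof. by rewrite tofrac_eq0 polyX_eq0. Qed.

Let phiw (d : {fset int * int}) f : msupp f `<=` d ->
  phi f = \sum_(k <- d) val_term f@_k k.
Proof.
move=> le; apply: big_fset_incl => // k _ /mcoeff_outdom ->.
by rewrite /val_term /cst !rmorph0 mul0r.
Qed.

Let phi_term c k : phi (term c k) = val_term c k.
Proof. by rewrite (phiw (msupp_term _ _)) big_seq_fset1 coef_term eqxx. Qed.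

Let phi0 : phi 0 = 0.
Proof. by rewrite /phi msupp0 big_seq_fset0. Qed.

Let phiD : {morph phi : f g / f + g}.
Proof.
move=> f g; rewrite (phiw (msuppD_le _ _)) (phiw (fsubsetUl _ (msupp g))).
rewrite (phiw (fsubsetUr (msupp f) _)) -big_split /=.
by apply: eq_bigr => k _; rewrite mcoeffD /val_term /cst !rmorphD mulrDl.
Qed.

Let phi_zmod : zmod_morphism phi.
Proof. by move=> f g; apply: (canRL (addrK _)); rewrite -phiD subrK. Qed.

Let phi_monoid : monoid_morphism phi.
Proof.
split; first by rewrite phi_term /val_term /cst !rmorph1 !expr0z !mul1r.
move=> f g; elim/laurent_ind: f => [|f1 f2 I1 I2|c k].
- by rewrite !(mul0r, phi0).
- by rewrite mulrDl !phiD I1 I2 mulrDl.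
elim/laurent_ind: g => [|g1 g2 I1 I2|d l].
- by rewrite !(mulr0, phi0).
- by rewrite mulrDr !phiD I1 I2 mulrDr.
rewrite termM !phi_term /val_term /cst !rmorphM !expfzDr //=.
by rewrite [RHS]mulrACA [Z in _ = _ * Z]mulrACA.
Qed.

Let phi_inj f : phi f = 0 -> f = 0.
Proof.
move=> f0.
pose N := (\max_(k <- msupp f) (`|k.1| + `|k.2|))%N.
have ge k : k \in msupp f -> (`|k.1| + `|k.2| <= N)%N.
  by move=> kf; rewrite /N (big_fsetD1 k) //= leq_maxl.
pose a k := `|(k.1 + N%:Z)%R|%N; pose b k := `|(k.2 + N%:Z)%R|%N.
have aE k : k \in msupp f -> (a k)%:Z = k.1 + N%:Z by move/ge; rewrite /a; lia.
have bE k : k \in msupp f -> (b k)%:Z = k.2 + N%:Z by move/ge; rewrite /b; lia.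
pose P : {poly {poly F}} := \sum_(k <- msupp f) (f@_k *: 'X^(a k)) *: 'X^(b k).
have PE : tofrac P = phi f * (X ^+ N * Y ^+ N).
  rewrite /phi mulr_suml raddf_sum /= big_seq [RHS]big_seq.
  apply: eq_bigr => k kf; rewrite /val_term (exprnP X) (exprnP Y).
  rewrite -mulrA mulrACA -(expfzDr _ _ X0) -(expfzDr _ _ Y0) -aE // -bE // -!exprnP.
  by rewrite -!mul_polyC !rmorphM !rmorphXn /= mulrA.
have P0 : P = 0 by apply/eqP; rewrite -tofrac_eq0 PE f0 mul0r.
apply/malgP => k; rewrite mcoeff0; case: msuppP => // kf.
have := congr1 (fun p : {poly {poly F}} => p`_(b k)`_(a k)) P0.
rewrite !coef0 /P coef_sum coef_sum (big_fsetD1 k) //= big1_fset => [|l].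
  by rewrite addr0 coefZ coefXn eqxx mulr1 coefZ coefXn eqxx mulr1.
rewrite in_fsetD1 => /andP[lk lf] _; rewrite coefZ coefXn.
have [eb|_] := eqVneq (b k) (b l); last by rewrite mulr0 coef0.
rewrite mulr1 coefZ coefXn; have [ea|_] := eqVneq (a k) (a l); last by rewrite mulr0.
case/eqP: lk; case: k l kf lf ea eb => [k1 k2] [l1 l2] kf lf ea eb.
have /= := aE _ kf; have /= := aE _ lf; have /= := bE _ kf; have /= := bE _ lf.
rewrite ea eb => -> bk -> ak.
by congr pair; [apply: (addIr N%:Z ak) | apply: (addIr N%:Z bk)].
Qed.

(* F(x, y) has an extension containing a square root of y^2 - x^2. *)
Lemma sqrt_extension_exists :
  exists (K : fieldType) (i : {rmorphism laurent F -> K}) (s : K),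
    injective i /\ s ^+ 2 = i (ly ^+ 2 - lx ^+ 2).
Proof.
pose i : {rmorphism laurent F -> K0} := HB.pack phi
  (GRing.isZmodMorphism.Build (laurent F) K0 phi phi_zmod)
  (GRing.isMonoidMorphism.Build (laurent F) K0 phi phi_monoid).
have inji : injective i.
  move=> f g fg; have {}fg : phi f = phi g := fg.
  by apply/subr0_eq/phi_inj; rewrite phi_zmod fg subrr.
have [L [j [s sq]]] := adjoin_sqrt (i (ly ^+ 2 - lx ^+ 2)).
exists L, (j \o i), s; split; last exact: sq.
by apply: inj_comp inji; apply: fmorph_inj.
Qed.

End SquareRoot.

(* A formal power series in t is its sequence of coefficients; adding series
   and multiplying or dividing them by constants is coefficientwise. *)
Definition fps (A : Type) : Type := nat -> A.

Definition Gen (F : fieldType) (f : laurent F) : fps (laurent F) :=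
  fun n => (n`!%:R)^-1 *: iter n (@Dxy F) f.

(* The series cosh(ts) and sinh(ts) in t. *)
Definition cosh_fps (K : fieldType) (s : K) : fps K :=
  fun n => if odd n then 0 else s ^+ n / n`!%:R.

Definition sinh_fps (K : fieldType) (s : K) : fps K :=
  fun n => if odd n then s ^+ n / n`!%:R else 0.

(* Main.v *)
(* The form w = y^2 - x^2 is a constant of the derivation D, and
   D(x^-1) = - x^-1 y, D^2(x^-1) = w x^-1.  Hence D^(2m)(x^-1) = w^m x^-1 and
   D^(2m+1)(x^-1) = - w^m x^-1 y, which are the coefficients of the expansion
   of the closed form, since w = s^2. *)
Require Import Defs.
From HB Require Import structures.
From mathcomp Require Import all_boot all_algebra all_field.
From mathcomp Require Import ring.

Set Implicit Arguments.
Unset Strict Implicit.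
Unset Printing Implicit Defensive.

Import GRing.Theory.
Local Open Scope ring_scope.

Section IteratedDerivation.
Variable F : fieldType.
Implicit Types (f g : laurent F) (m : nat).

Lemma DxyN f : Dxy (- f) = - Dxy f.
Proof. by apply: (addrI (Dxy f)); rewrite -DxyD !subrr Dxy0. Qed.

Lemma Dxy_lxV : Dxy lxV = - (lxV * ly) :> laurent F.
Proof.
by rewrite Dxy_term /= mul0r term0 addr0 termM -scaleN1r termZ !mulr1.
Qed.

Lemma Dxy_sqrB : Dxy (ly ^+ 2 - lx ^+ 2) = 0 :> laurent F.
Proof. by rewrite DxyD DxyN !expr2 !DxyM Dxy_ly Dxy_lx; ring. Qed.

(** The exponent [(0, 2)] has coefficient 1, as [lx ^+ 2] contributes nothing there. This will give
    [s != 0]. *)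
Lemma sqrB_neq0 : ly ^+ 2 - lx ^+ 2 != 0 :> laurent F.
Proof.
apply/eqP => /monalg.malgP /(_ (0, 2)) /eqP.
by rewrite !expr2 !termM monalg.mcoeffB !coef_term monalg.mcoeff0 subr0 mulr1 oner_eq0.
Qed.

Lemma Dxy2_lxV : Dxy (Dxy lxV) = (ly ^+ 2 - lx ^+ 2) * lxV :> laurent F.
Proof. by rewrite Dxy_lxV DxyN DxyM Dxy_lxV Dxy_ly; ring. Qed.

(** The Leibniz term containing [Dxy g] vanishes. The induction keeps [f] general because each step
    moves one factor [g] into it. *)
Lemma Dxy_exp_mul g m f : Dxy g = 0 -> Dxy (g ^+ m * f) = g ^+ m * Dxy f.
Proof.
move=> Dg; elim: m f => [|m IHm] f; first by rewrite !expr0 !mul1r.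
by rewrite !exprSr -!mulrA IHm DxyM Dg mul0r add0r.
Qed.

Lemma iter_double_Dxy_lxV m :
  iter m.*2 (@Dxy F) lxV = (ly ^+ 2 - lx ^+ 2) ^+ m * lxV.
Proof.
elim: m => [|m IHm]; first by rewrite expr0 mul1r.
rewrite doubleS !iterS IHm !(Dxy_exp_mul _ _ Dxy_sqrB) Dxy2_lxV.
by rewrite (exprSr _ m) mulrA.
Qed.

Lemma iter_double_succ_Dxy_lxV m :
  iter m.*2.+1 (@Dxy F) lxV = - ((ly ^+ 2 - lx ^+ 2) ^+ m * lxV * ly).
Proof.
by rewrite iterS iter_double_Dxy_lxV (Dxy_exp_mul _ _ Dxy_sqrB) Dxy_lxV mulrN mulrA.
Qed.

End IteratedDerivation.

Theorem theorem2p3 (F : fieldType) (charF0 : [pchar F] =i pred0)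
    (K : fieldType) (i : {rmorphism laurent F -> K}) (inj_i : injective i)
    (s : K) (s_sqrt : s ^+ 2 = i (ly ^+ 2 - lx ^+ 2)) (n : nat) :
  i (Gen lxV n) =
    (s * cosh_fps s n - i ly * sinh_fps s n) / (i lx * s).
Proof.
have s0 : s != 0.
  by rewrite -sqrf_eq0 s_sqrt -(rmorph0 i) (inj_eq inj_i) sqrB_neq0.
have xV : i lx * i lxV = 1 by rewrite -rmorphM mul_lx_lxV rmorph1.
have x0 : i lx != 0.
  by apply: contra_eq_neq xV => ->; rewrite mul0r eq_sym oner_eq0.
have {xV}xV : i lxV = (i lx)^-1 by apply: (mulfI x0); rewrite xV divff.
have factF : n`!%:R != 0 :> F.
  by rewrite ((pcharf0P F).1 charF0) -lt0n fact_gt0.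
(* Characteristic zero makes [n!] invertible in [F], so it cancels the scalar in [Gen]. *)
have GenE : n`!%:R * i (Gen lxV n) = i (iter n (@Dxy F) lxV).
  by rewrite -(rmorph_nat i) -rmorphM mulr_natl -scaler_nat scalerA divff ?scale1r.
(* [K] inherits this from [F] through the injective [i]. *)
have factK : n`!%:R != 0 :> K.
  rewrite -(rmorph_nat i) -(rmorph0 i) (inj_eq inj_i).
  by rewrite -(scaler_nat _ 1) scaler_eq0 (negPf factF) oner_eq0.
apply: (mulfI factK); rewrite {}GenE /cosh_fps /sinh_fps.
(* Once generalized, the factorial is untouched by the parity split of [n]. *)
move: (n`!%:R : K) factK => N N0.
have := esym (odd_double_half n); move: n./2 => m; case: (odd n) => ->.
  (* Odd case: only [sinh_fps] survives, and one [s] of [s ^+ m.*2.+1] cancels the denominator,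
     leaving [(s ^+ 2) ^+ m]. *)
  rewrite add1n iter_double_succ_Dxy_lxV rmorphN !rmorphM rmorphXn -s_sqrt /= xV.
  by rewrite (exprS _ m.*2) -mul2n exprM; field; rewrite x0 s0 N0.
(* Even case: only [cosh_fps] survives, and its prefactor [s] cancels the denominator. *)
rewrite add0n iter_double_Dxy_lxV rmorphM rmorphXn -s_sqrt /= xV.
by rewrite -mul2n exprM; field; rewrite x0 s0 N0.
Qed.
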